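(* Let $J=\Delta+K$ be a Jacobi operator where $K$ is trace class, let $c$ and $c_\mu$ be the Toeplitz symbols (analytic on the open unit disc $\mathbb D$) of the Toeplitz parts of $C_{J\to\Delta}$ and $C^\mu_{J\to\Delta}$, and let $\lambda(z)=\frac12(z+z^{-1})$. Then for every $z\in\mathbb D\setminus\{0\}$ such that $\lambda(z)\notin\sigma(J)$, the principal resolvent $G$ of $J$ is given by the meromorphic function $$G(\lambda(z))=-\frac{c_\mu(z)}{c(z)}.$$ Therefore, all eigenvalues of $J$ are of the form $\lambda(z_k)$, where $z_k$ is a root of $c$ in $\mathbb D$.
   Context: All matrices are indexed from $0$. A Jacobi operator $J$ is a bounded self-adjoint operator on $\ell^2(\{0,1,2,\dots\})$ given by a symmetric tridiagonal matrix with real diagonal entries $J_{k,k}=\alpha_k$ and off-diagonal entries $J_{k,k+1}=J_{k+1,k}=\beta_k>0$. Its spectrum is denoted $\sigma(J)$. Its principal resolvent is $G(\lambda)=\langle e_0,(J-\lambda)^{-1}e_0\rangle$ for $\lambda\in\mathbb C\setminus\sigma(J)$, where $e_0$ is the first standard basis vector. Its orthonormal polynomials are defined by $P_{-1}=0$, $P_0=1$, $sP_k(s)=\beta_{k-1}P_{k-1}(s)+\alpha_kP_k(s)+\beta_kP_{k+1}(s)$. Its first associated polynomials are defined by $P_0^\mu=0$, $P_1^\mu=\beta_0^{-1}$, and $sP^\mu_k(s)=\beta_{k-1}P^\mu_{k-1}(s)+\alpha_kP^\mu_k(s)+\beta_kP^\mu_{k+1}(s)$ for $k\ge1$. The free Jacobi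 operator $\Delta$ has diagonal entries $0$ and off-diagonal entries $\tfrac12$; its orthonormal polynomials are the Chebyshev polynomials of the second kind $U_k$. The matrices $C_{J\to\Delta}=(c_{i,j})$ and $C^\mu_{J\to\Delta}=(c^\mu_{i,j})$ are the upper triangular matrices defined by $P_k=\sum_{i=0}^kc_{i,k}U_i$ and $P^\mu_k=\sum_{i=0}^kc^\mu_{i,k}U_i$. That $K=J-\Delta$ is trace class means $\sum_{k\ge0}\left(|\alpha_k|+|\beta_k-\frac12|\right)<\infty$. In this case the limits $t_k=\lim_{i\to\infty}c_{i,i+k}$ and $t^\mu_k=\lim_{i\to\infty}c^\mu_{i,i+k}$ exist for every $k\ge0$; the Toeplitz parts of $C_{J\to\Delta}$ and $C^\mu_{J\to\Delta}$ are the upper triangular Toeplitz matrices with $(i,j)$ entries $t_{j-i}$ and $t^\mu_{j-i}$ for $j\ge i$, and their Toeplitz symbols $c(z)=\sum_{k\ge0}t_kz^k$ and $c_\mu(z)=\sum_{k\ge0}t^\mu_kz^k$ are analytic on $\mathbb D$.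
   Formalization: The eigenvalue sentence is stated for all eigenvalues of J other than 1 and −1, since J may have an eigenvalue at ±1 (e.g. β_k=1/2, α_0=3/4, α_k=−1/(k(k+2)), eigenvector 1/(k+1)), which is not λ(z) for any z in the open disc. *)

(* Defs.v *)
From mathcomp Require Import all_boot all_order all_algebra.
From mathcomp Require Import complex.
From mathcomp Require Import all_classical all_reals all_analysis.

Set Implicit Arguments.
Unset Strict Implicit.
Unset Printing Implicit Defensive.

Import Order.TTheory GRing.Theory Num.Theory.
Import numFieldNormedType.Exports.

Local Open Scope ring_scope.
Local Open Scope complex_scope.
Local Open Scope classical_set_scope.

Section JacobiOperators.
Variable R : realType.
(* [R[i]] itself carries no topology; [R[i]^o] has the one induced by the
   modulus. *)
Local Notation C := (R[i])^o.

(* Square-summable sequences; [complex.Re `|x|] is the modulus as an element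
   of [R]. *)
Definition sqmod (x : C) : R := complex.Re (`|x|) ^+ 2.

Definition ell2 : set (nat -> C) :=
  [set u | cvgn (series (fun k => sqmod (u k)))].

Definition norm2 (u : nat -> C) : R :=
  Num.sqrt (limn (series (fun k => sqmod (u k)))).

Definition inner (u v : nat -> C) : C :=
  limn (series (fun k => (u k)^* * v k : C)).

Definition e0 : nat -> C := fun k => (k == 0)%:R.

(* Operators on ell2 are functions on all sequences; only their values on
   [ell2] matter. *)
Definition bounded_operator (T : (nat -> C) -> (nat -> C)) : Prop :=
  [/\ forall u, ell2 u -> ell2 (T u),
      forall (a : C) u v, ell2 u -> ell2 v ->
        T (fun k => a * u k + v k) = (fun k => a * T u k + T v k)
    & exists M : R, forall u, ell2 u -> norm2 (T u) <= M * norm2 u].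

Definition shift_operator (T : (nat -> C) -> (nat -> C)) (lam : C) :
  (nat -> C) -> (nat -> C) := fun u k => T u k - lam * u k.

(* The inverse of [T - lam] as a map from [ell2] to [ell2]. *)
Definition resolvent (T : (nat -> C) -> (nat -> C)) (lam : C) :
  (nat -> C) -> (nat -> C) :=
  'pinv_(fun u => u) ell2 (shift_operator T lam).

Definition spectrum (T : (nat -> C) -> (nat -> C)) : set C :=
  [set lam | ~ (set_bij ell2 ell2 (shift_operator T lam) /\
                bounded_operator (resolvent T lam))].

(* An eigenvalue of a trace class perturbation of the free operator may sit at
   an edge of the essential spectrum [-1, 1], where it is not of the form
   [joukowski z] with [`|z| < 1]: for [beta k = 1/2], [alpha 0 = 3/4] and
   [alpha k = - 1/(k(k+2))], k >= 1, the vector [u k = 1/(k+1)] is an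
   eigenvector for the eigenvalue 1. *)
Definition is_eigenvalue (T : (nat -> C) -> (nat -> C)) (lam : C) : Prop :=
  exists u, [/\ ell2 u, u <> (fun=> 0) & T u = (fun k => lam * u k)].

Definition principal_resolvent (T : (nat -> C) -> (nat -> C)) (lam : C) : C :=
  inner e0 (resolvent T lam e0).

Definition tridiag (alpha beta : nat -> R) (u : nat -> C) : nat -> C :=
  fun k => (if k is j.+1 then (beta j)%:C * u j else 0)
           + (alpha k)%:C * u k + (beta k)%:C * u k.+1.

(* Self-adjointness is automatic, the matrix being real and symmetric. *)
Definition jacobi (alpha beta : nat -> R) : Prop :=
  (forall k, 0 < beta k) /\ bounded_operator (tridiag alpha beta).

Definition free_alpha : nat -> R := fun=> 0.
Definition free_beta : nat -> R := fun=> 2^-1.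

Definition trace_class_perturbation (alpha beta : nat -> R) : Prop :=
  cvgn (series (fun k => `|alpha k - free_alpha k| + `|beta k - free_beta k|)).

Fixpoint orthopoly (alpha beta : nat -> R) (k : nat) : {poly R} :=
  if k is j.+1 then
    (beta j)^-1 *:
      (('X - (alpha j)%:P) * orthopoly alpha beta j
       - (if j is i.+1 then beta i *: orthopoly alpha beta i else 0))
  else 1.

Fixpoint assocpoly (alpha beta : nat -> R) (k : nat) : {poly R} :=
  if k is j.+1 then
    if j is i.+1 then
      (beta j)^-1 *:
        (('X - (alpha j)%:P) * assocpoly alpha beta j
         - beta i *: assocpoly alpha beta i)
    else ((beta 0%N)^-1)%:P
  else 0.

Definition chebyshevU : nat -> {poly R} := orthopoly free_alpha free_beta.

(* The matrix [c] is unique, since [chebyshevU i] has degree [i]. *)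
Definition connection_matrix (P : nat -> {poly R}) (c : nat -> nat -> R) :
  Prop :=
  (forall i k, (k < i)%N -> c i k = 0) /\
  (forall k, P k = \sum_(i < k.+1) c i k *: chebyshevU i).

Definition toeplitz_coef (c : nat -> nat -> R) (k : nat) : R :=
  limn (fun i => c i (i + k)%N).

Definition toeplitz_symbol (c : nat -> nat -> R) (z : C) : C :=
  limn (series (fun k => (toeplitz_coef c k)%:C * z ^+ k : C)).

(* [lim] is a total function: this says that the limits in the two preceding
   definitions exist, so that the symbol is analytic on the unit disc. *)
Definition has_toeplitz_symbol (c : nat -> nat -> R) : Prop :=
  (forall k, cvgn (fun i => c i (i + k)%N)) /\
  (forall z : C, `|z| < 1 ->
     cvgn (series (fun k => (toeplitz_coef c k)%:C * z ^+ k : C))).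

Definition joukowski (z : C) : C := 2^-1 * (z + z^-1).

End JacobiOperators.

(* Main.v *)
Require Import Defs.
From mathcomp Require Import all_boot all_order all_algebra.
From mathcomp Require Import complex.
From mathcomp Require Import all_classical all_reals all_analysis.
From mathcomp Require Import ring lra.
Import Order.TTheory GRing.Theory Num.Theory.
Import numFieldNormedType.Exports.
Local Open Scope ring_scope.
Local Open Scope complex_scope.
Local Open Scope classical_set_scope.
Set Implicit Arguments.
Unset Strict Implicit.
Unset Printing Implicit Defensive.

(* Put H k = (1 - z^2) z^k P k ((z + 1/z)/2), a polynomial in z whose
   coefficients of degree at most k are the entries c (k - j) k. The three-term
   recurrence makes the increments of H contract by z^2 up to a summable
   multiple of H, so for every rho < 1 the coefficients of H k, weighted by
   rho^j, converge uniformly in j. Hence c(z) = lim (1 - z^2) z^k P k, and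
   likewise for the associated polynomials. The vector u = (J - lambda)^-1 e0 is
   G P + Pmu; it tends to 0, so G c(z) + cmu(z) = 0. The symbols c and cmu have
   no common zero: a solution whose component along z^(-k) dominates at a late
   stage never satisfies z^k w k --> 0. An eigenvector is a multiple of P and
   tends to 0, which gives c(z) = 0 if |z| < 1, and is impossible if |z| = 1 and
   z^2 <> 1, where all nonzero solutions stay bounded away from 0. *)

(** * Real-valued modulus and convergence of complex sequences *)

Section Modulus.
Variable R : realType.
Implicit Types x y : R[i].

(** The norm of [R[i]] takes values in [R[i]]; its real part carries the same information into [R],
    where [lra], [nra] and the theory of real sequences apply. *)
Definition modc (x : R[i]) : R := complex.Re `|x|.

Lemma normE_modc x : `|x| = (modc x)%:C.
Proof. by []. Qed.

Lemma modc_ge0 x : 0 <= modc x.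
Proof. by rewrite -lecR -normE_modc normr_ge0. Qed.

Lemma modc0 : modc 0 = 0.
Proof. by apply: complexI; rewrite -normE_modc normr0. Qed.

Lemma modc1 : modc 1 = 1.
Proof. by apply: complexI; rewrite -normE_modc normr1. Qed.

Lemma modcM x y : modc (x * y) = modc x * modc y.
Proof. by apply: complexI; rewrite rmorphM/= -!normE_modc normrM. Qed.

Lemma modcX x n : modc (x ^+ n) = modc x ^+ n.
Proof. by apply: complexI; rewrite rmorphXn/= -!normE_modc normrX. Qed.

Lemma modcN x : modc (- x) = modc x.
Proof. by apply: complexI; rewrite -!normE_modc normrN. Qed.

Lemma modcD x y : modc (x + y) <= modc x + modc y.
Proof. by rewrite -lecR rmorphD/= -!normE_modc ler_normD. Qed.

Lemma modcB x y : modc (x - y) <= modc x + modc y.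
Proof. by rewrite -(modcN y) modcD. Qed.

Lemma modcBC x y : modc (x - y) = modc (y - x).
Proof. by rewrite -modcN opprB. Qed.

Lemma modc_real (r : R) : modc r%:C = `|r|.
Proof. by rewrite /modc normc_def/= expr0n/= addr0 sqrtr_sqr. Qed.

Lemma modc_eq0 x : (modc x == 0) = (x == 0).
Proof.
by rewrite -(normr_eq0 x) normE_modc -(inj_eq (@complexI R)).
Qed.

Lemma modc_gt0 x : (0 < modc x) = (x != 0).
Proof. by rewrite lt_def modc_ge0 andbT modc_eq0. Qed.

Lemma modc_sum n (u : nat -> R[i]) :
  modc (\sum_(k < n) u k) <= \sum_(k < n) modc (u k).
Proof.
elim: n => [|n IH]; first by rewrite !big_ord0 modc0.
by rewrite !big_ord_recr/= (le_trans (modcD _ _))// lerD2r.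
Qed.

Lemma normr_lt1_modc x : (`|x| < 1) = (modc x < 1).
Proof. by rewrite normE_modc -(ltcR (modc x) 1). Qed.

Lemma abs_Re_modc x : `|complex.Re x| <= modc x.
Proof. by rewrite -lecR -normE_modc normc_ge_Re. Qed.

Lemma abs_Im_modc x : `|complex.Im x| <= modc x.
Proof.
rewrite /modc normc_def/= -sqrtr_sqr ler_wsqrtr//.
by rewrite lerDr sqr_ge0.
Qed.

Lemma modc_le_ReIm x : modc x <= `|complex.Re x| + `|complex.Im x|.
Proof.
rewrite /modc normc_def/= -[leRHS]ger0_norm ?addr_ge0// -sqrtr_sqr.
rewrite ler_wsqrtr// -(real_normK (num_real (complex.Re x))).
rewrite -(real_normK (num_real (complex.Im x))).
have := normr_ge0 (complex.Re x); have := normr_ge0 (complex.Im x); nra.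
Qed.

Lemma cvg_modcP (u : nat -> R[i]) (l : R[i]) :
  ((u : nat -> (R[i])^o) @ \oo --> (l : (R[i])^o)) <->
  ((fun k => modc (u k - l)) @ \oo --> (0 : R)).
Proof.
split=> [/cvgrPdist_lt h|/cvgrPdist_lt h].
- apply/cvgrPdist_lt => e e0.
  have : (0 : R[i]) < e%:C by rewrite (ltcR 0 e).
  move=> /h; apply: filterS => k.
  rewrite (_ : `|_| = (modc (l - u k))%:C)// ltcR sub0r normrN.
  by rewrite ger0_norm ?modc_ge0// modcBC.
- apply/cvgrPdist_lt => e e0.
  (* The order of [R[i]] compares only numbers with equal imaginary parts, so a positive [e] is
     real. *)
  have [eI eR] : e = (complex.Re e)%:C /\ 0 < complex.Re e.
    by case: e e0 => a b; rewrite ltcE/= => /andP[/eqP -> ->].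
  have := h _ eR; apply: filterS => k.
  rewrite eI (_ : `|_ - _ : (R[i])^o| = (modc (l - u k))%:C)// ltcR sub0r normrN.
  by rewrite ger0_norm ?modc_ge0// modcBC.
Qed.

Lemma cvg0_modcP (u : nat -> R[i]) :
  ((u : nat -> (R[i])^o) @ \oo --> (0 : (R[i])^o)) <->
  ((fun k => modc (u k)) @ \oo --> (0 : R)).
Proof.
have -> : (fun k => modc (u k)) = (fun k => modc (u k - 0)).
  by apply/funext => k; rewrite subr0.
exact: cvg_modcP.
Qed.

Lemma cvg0_modc_le (u : nat -> R[i]) (v : nat -> R) :
  (forall k, modc (u k) <= v k) -> v @ \oo --> (0 : R) ->
  (u : nat -> (R[i])^o) @ \oo --> (0 : (R[i])^o).
Proof.
move=> uv v0; apply/cvg0_modcP; apply: (squeeze_cvgr _ (cvg_cst 0) v0).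
by apply: nearW => k; rewrite modc_ge0 uv.
Qed.

Lemma cvg_complex_lim (u : nat -> R[i]) (l : R[i]) :
  ((u : nat -> (R[i])^o) @ \oo --> (l : (R[i])^o)) ->
  limn (u : nat -> (R[i])^o) = l.
Proof. exact: (cvg_lim (@norm_hausdorff _ _)). Qed.

Lemma cvg_complex_unique (u : nat -> R[i]) (l l' : R[i]) :
  ((u : nat -> (R[i])^o) @ \oo --> (l : (R[i])^o)) ->
  ((u : nat -> (R[i])^o) @ \oo --> (l' : (R[i])^o)) -> l = l'.
Proof. by move=> /cvg_complex_lim <- /cvg_complex_lim <-. Qed.

Lemma cvg_complex_ReIm (u : nat -> R[i]) :
  cvgn (fun k => complex.Re (u k)) -> cvgn (fun k => complex.Im (u k)) ->
  cvgn (u : nat -> (R[i])^o).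
Proof.
move=> /cvg_ex[/= a ua] /cvg_ex[/= b ub].
apply/cvg_ex; exists (a +i* b : R[i]); apply/cvg_modcP.
apply: (@squeeze_cvgr _ _ _ _ (cst 0)
    (fun k => `|complex.Re (u k) - a| + `|complex.Im (u k) - b|)).
- apply: nearW => k; rewrite modc_ge0/= (le_trans (modc_le_ReIm _))//.
  by case: (u k).
- exact: cvg_cst.
- rewrite -[0]addr0; apply: cvgD; apply/norm_cvg0P.
    by rewrite -(subrr a); apply: cvgB => //; exact: cvg_cst.
  by rewrite -(subrr b); apply: cvgB => //; exact: cvg_cst.
Qed.

Lemma Re_sum n (u : nat -> R[i]) :
  complex.Re (\sum_(k < n) u k) = \sum_(k < n) complex.Re (u k).
Proof.
elim: n => [|n IH]; first by rewrite !big_ord0.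
by rewrite !big_ord_recr/= -IH; case: (\sum_(_ < _) _); case: (u n).
Qed.

Lemma Im_sum n (u : nat -> R[i]) :
  complex.Im (\sum_(k < n) u k) = \sum_(k < n) complex.Im (u k).
Proof.
elim: n => [|n IH]; first by rewrite !big_ord0.
by rewrite !big_ord_recr/= -IH; case: (\sum_(_ < _) _); case: (u n).
Qed.

(** Real and imaginary parts are dominated by the modulus, so each converges absolutely in [R]. *)
Lemma cvg_series_modc (u : nat -> R[i]) :
  cvgn (series (fun k => modc (u k))) ->
  cvgn (series (u : nat -> (R[i])^o)).
Proof.
move=> us; apply: cvg_complex_ReIm.
- have -> : (fun k => complex.Re (series (u : nat -> (R[i])^o) k)) =
      series (fun k => complex.Re (u k)).
    by apply/funext => k; rewrite /series/= !big_mkord Re_sum.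
  apply: normed_cvg; apply: (series_le_cvg _ _ _ us) => k /=.
  - exact: normr_ge0.
  - exact: modc_ge0.
  - exact: abs_Re_modc.
- have -> : (fun k => complex.Im (series (u : nat -> (R[i])^o) k)) =
      series (fun k => complex.Im (u k)).
    by apply/funext => k; rewrite /series/= !big_mkord Im_sum.
  apply: normed_cvg; apply: (series_le_cvg _ _ _ us) => k /=.
  - exact: normr_ge0.
  - exact: modc_ge0.
  - exact: abs_Im_modc.
Qed.

End Modulus.

(** * Real recurrences with summable perturbations *)

Section SummableRecurrences.
Variable R : realType.
Implicit Types e x : nat -> R.

Lemma summable_tail e (d : R) : (forall k, 0 <= e k) -> cvgn (series e) ->
  0 < d -> exists N, forall n, \sum_(N <= k < n) e k <= d.
Proof.
move=> e0 es d0.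
have nd : nondecreasing_seq (series e) by exact: nondecreasing_series.
have /cvgrPdist_lt/(_ _ d0)[N _ hN] := es.
exists N => n; have [nN|/ltnW Nn] := leqP n N.
  by rewrite big_geq// ltW.
have := hN _ (leqnn N); rewrite /= ltr_norml => /andP[_ hd].
have := nondecreasing_cvgn_le nd es n.
have : series e n - series e N = \sum_(N <= k < n) e k.
  by rewrite sub_series_geq.
by move=> <-; lra.
Qed.

Lemma summable_shift e : (forall k, 0 <= e k) -> cvgn (series e) ->
  cvgn (series (fun k => e k.+1)).
Proof.
move=> e0 es; apply: nondecreasing_is_cvgn; first exact: nondecreasing_series.
exists (limn (series e)) => _ [n _ <-].
have nd : nondecreasing_seq (series e) by exact: nondecreasing_series.
apply: le_trans (nondecreasing_cvgn_le nd es n.+1).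
by rewrite /series/= big_nat_recl//= lerDr.
Qed.

(** The product of the factors [1 - e k] is at least one minus the sum of the [e k], hence at least
    1/2. *)
Lemma summable_lower_bound e x N : (forall k, 0 <= e k) ->
  (forall n, \sum_(N <= k < n) e k <= 2^-1) ->
  0 < x N -> (forall k, (N <= k)%N -> (1 - e k) * x k <= x k.+1) ->
  forall n, (N <= n)%N -> x N / 2 <= x n.
Proof.
move=> e0 es xN h n Nn.
suff : (1 - \sum_(N <= k < n) e k) * x N <= x n.
  apply: le_trans.
  rewrite mulrC ler_wpM2r//; first exact: ltW.
  by have := es n; lra.
elim: n Nn => [|n IH].
  by rewrite leqn0 => /eqP <-; rewrite big_geq// subr0 mul1r.
rewrite leq_eqVlt => /orP[/eqP <-|]; first by rewrite big_geq// subr0 mul1r.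
rewrite ltnS => Nn; apply: le_trans (h _ Nn); rewrite big_nat_recr//=.
have := IH Nn; have := es n.+1; rewrite big_nat_recr//=; have := e0 n.
have : 0 <= \sum_(N <= k < n) e k by apply: sumr_ge0.
set s := \sum_(_ <= _ < _) _; set y := x N in xN *; set w := x n.
set t := e n => s0 t0 st hw.
have : (1 - t) * ((1 - s) * y) <= (1 - t) * w by rewrite ler_wpM2l//; lra.
apply: le_trans; rewrite mulrA ler_wpM2r//; [exact: ltW|nra].
Qed.

(* With kappa = g / (1 - r), the quantity N + kappa E is multiplied by at most
   1 + kappa * e k at each step. *)
Lemma summable_coupled_bound e (g r : R) (N E : nat -> R) :
  (forall k, 0 <= e k) -> cvgn (series e) -> 0 <= g -> 0 <= r < 1 ->
  0 <= N 0%N -> 0 <= E 0%N ->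
  (forall k, N k.+1 = N k + g * E k) ->
  (forall k, E k.+1 = r * E k + e k * N k.+1) ->
  [/\ forall k, 0 <= N k, forall k, 0 <= E k & cvgn N].
Proof.
move=> e0 es g0 /andP[r0 r1] N0 E0 NS ES.
have NE k : 0 <= N k /\ 0 <= E k.
  elim: k => // k [Nk Ek].
  have Nk1 : 0 <= N k.+1 by rewrite NS addr_ge0// mulr_ge0.
  by split => //; rewrite ES addr_ge0// mulr_ge0.
split => [k|k|]; [exact: (NE k).1|exact: (NE k).2|].
pose kap := g / (1 - r).
have kap0 : 0 <= kap by rewrite divr_ge0// subr_ge0 ltW.
have kapE : kap * (1 - r) = g by rewrite /kap divfK// subr_eq0 gt_eqF.
have gk : g <= kap by rewrite -kapE; nra.
pose L k := N k + kap * E k.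
(* Since 1 + t <= exp t, the product of the step factors is bounded by the exponential of a partial
   sum of [e]. *)
have LS k : L k.+1 <= L k * expR (kap * e k).
  have [Nk Ek] := NE k.
  have NL : N k.+1 <= L k by rewrite NS lerD2l ler_wpM2r.
  have -> : L k.+1 = L k + kap * e k * N k.+1.
    by rewrite /L ES NS -kapE; ring.
  apply: (@le_trans _ _ (L k * (1 + kap * e k))).
    by rewrite mulrDr mulr1 lerD2l mulrC ler_wpM2r// mulr_ge0.
  rewrite ler_wpM2l ?expR_ge1Dx//.
  by rewrite addr_ge0// mulr_ge0.
have LB n : L n <= L 0%N * expR (kap * series e n).
  elim: n => [|n IH]; first by rewrite /series/= big_geq// mulr0 expR0 mulr1.
  rewrite seriesSr mulrDr expRD mulrA (le_trans (LS n))//.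
  by rewrite ler_wpM2r// expR_ge0.
apply: nondecreasing_is_cvgn.
  apply/nondecreasing_seqP => k; rewrite NS lerDl mulr_ge0//.
  exact: (NE k).2.
exists (L 0%N * expR (kap * limn (series e))) => _ [n _ <-].
apply: (@le_trans _ _ (L n)).
  by rewrite lerDl mulr_ge0//; exact: (NE n).2.
apply: (le_trans (LB n)); rewrite ler_wpM2l//.
  by rewrite addr_ge0// mulr_ge0.
rewrite ler_expR ler_wpM2l//; apply: nondecreasing_cvgn_le => //.
exact: nondecreasing_series.
Qed.

(** The increments of [h] are dominated by those of [N], whose series telescopes, so [h] is the sum
    of an absolutely convergent series. *)
Lemma telescope_cvg (h N : nat -> R) :
  (forall k, `|h k.+1 - h k| <= N k.+1 - N k) -> cvgn N -> cvgn h.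
Proof.
move=> hN Nc.
have tel (f : nat -> R) n : series (fun k => f k.+1 - f k) n = f n - f 0%N.
  elim: n => [|n IH]; first by rewrite /series/= big_geq// subrr.
  by rewrite seriesSr IH; ring.
have : cvgn (series (fun k => h k.+1 - h k)).
  apply: normed_cvg.
  apply: (@series_le_cvg _ _ (fun k => N k.+1 - N k)) => [k /=|k|k|].
  - exact: normr_ge0.
  - by apply: le_trans (hN k).
  - exact: hN.
  have -> : series (fun k => N k.+1 - N k) = (fun k => N k - N 0%N).
    by apply/funext => k; rewrite tel.
  by apply: is_cvgB => //; exact: is_cvg_cst.
move=> hs; have -> : h = (fun k => series (fun k => h k.+1 - h k) k + h 0%N).
  by apply/funext => k; rewrite tel subrK.
by apply: is_cvgD => //; exact: is_cvg_cst.
Qed.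

Lemma positive_lim_bounded_inv (b : nat -> R) (l : R) :
  (forall k, 0 < b k) -> 0 < l -> b @ \oo --> l ->
  exists2 g, 0 < g & forall k, (b k)^-1 <= g.
Proof.
move=> b0 l0 bl.
have /cvgV-/(_ (lt0r_neq0 l0)) := bl.
move=> /cvgP/cvg_seq_bounded/bounded_fun_has_ubound[M hM].
exists (Num.max M 1); first by rewrite lt_max ltr01 orbT.
by move=> k; rewrite le_max hM//; exists k.
Qed.

End SummableRecurrences.

(** * Weighted sup bounds on polynomial coefficients *)

Section WeightedCoefficients.
Variable R : realType.
Implicit Types (p q : {poly R}) (rho M : R).

Definition coef_bound rho p M := forall j, `|p`_j| * rho ^+ j <= M.

Lemma coef_bound_ex rho p : 0 <= rho -> exists2 M, 0 <= M & coef_bound rho p M.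
Proof.
move=> r0; exists (\sum_(j < size p) `|p`_j| * rho ^+ j).
  by apply: sumr_ge0 => j _; rewrite mulr_ge0// exprn_ge0.
move=> j; have [jp|pj] := ltnP j (size p).
  rewrite (bigD1 (Ordinal jp))//= lerDl.
  by apply: sumr_ge0 => i _; rewrite mulr_ge0// exprn_ge0.
rewrite nth_default// normr0 mul0r.
by apply: sumr_ge0 => i _; rewrite mulr_ge0// exprn_ge0.
Qed.

Lemma coef_boundD rho p q M N : 0 <= rho ->
  coef_bound rho p M -> coef_bound rho q N -> coef_bound rho (p + q) (M + N).
Proof.
move=> r0 pM qN j; rewrite coefD.
apply: (@le_trans _ _ (`|p`_j| * rho ^+ j + `|q`_j| * rho ^+ j)).
  by rewrite -mulrDl ler_wpM2r ?exprn_ge0// ler_normD.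
exact: lerD.
Qed.

Lemma coef_boundZ rho p M (s : R) :
  coef_bound rho p M -> coef_bound rho (s *: p) (`|s| * M).
Proof. by move=> pM j; rewrite coefZ normrM -mulrA ler_wpM2l. Qed.

(** Shifting coefficients by [n] places gains the weight [rho ^+ n]; this is the source of the
    contraction by [rho ^+ 2] below. *)
Lemma coef_boundXn rho p M n : 0 <= rho -> 0 <= M ->
  coef_bound rho p M -> coef_bound rho ('X^n * p) (rho ^+ n * M).
Proof.
move=> r0 M0 pM j; rewrite coefXnM; case: ltnP => [jn|nj].
  by rewrite normr0 mul0r mulr_ge0// exprn_ge0.
by rewrite -{2}(subnKC nj) exprD mulrCA ler_wpM2l ?exprn_ge0.
Qed.

Lemma coef_bound_le rho p M N : M <= N -> coef_bound rho p M ->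
  coef_bound rho p N.
Proof. by move=> MN pM j; exact: le_trans MN. Qed.

End WeightedCoefficients.

(** * Row-by-row size of the perturbation *)

Section Defect.
Variable R : realType.
Implicit Types alpha beta : nat -> R.

Definition defect alpha beta (k : nat) : R := `|alpha k| + `|beta k - 2^-1|.

Lemma defect_ge0 alpha beta k : 0 <= defect alpha beta k.
Proof. by rewrite addr_ge0. Qed.

Lemma trace_class_defect alpha beta :
  trace_class_perturbation alpha beta -> cvgn (series (defect alpha beta)).
Proof.
rewrite /trace_class_perturbation /free_alpha /free_beta /defect.
by under eq_fun do rewrite subr0.
Qed.

Lemma trace_class_beta_cvg alpha beta :
  trace_class_perturbation alpha beta -> beta @ \oo --> (2^-1 : R).
Proof.
move=> /trace_class_defect/cvg_series_cvg_0 d0.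
have : (fun k => beta k - 2^-1) @ \oo --> (0 : R).
  apply/norm_cvg0P; apply: (squeeze_cvgr _ (cvg_cst 0) d0).
  by apply: nearW => k; rewrite normr_ge0 lerDr normr_ge0.
move=> /cvgD/(_ (cvg_cst (2^-1 : R))); rewrite add0r.
by rewrite (_ : _ + _ = beta)//; apply/funext => k; rewrite /= subrK.
Qed.

(** Positivity alone would let [beta k] approach 0; the limit 1/2 prevents it. *)
Lemma trace_class_inv_bounded alpha beta :
  (forall k, 0 < beta k) -> trace_class_perturbation alpha beta ->
  exists2 g, 0 < g & forall k, (beta k)^-1 <= g.
Proof.
move=> b0 /trace_class_beta_cvg bl.
by apply: positive_lim_bounded_inv b0 _ bl; rewrite invr_gt0.
Qed.

(** One step of the recurrence involves the entries of two consecutive rows, hence this sum as error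
    weight. *)
Lemma defect_summable2 alpha beta : trace_class_perturbation alpha beta ->
  cvgn (series (fun k => defect alpha beta k + defect alpha beta k.+1)).
Proof.
move=> /trace_class_defect h.
have h' := summable_shift (@defect_ge0 alpha beta) h.
exact: is_cvg_seriesD h h'.
Qed.

End Defect.

(** * Increments of a perturbed polynomial recurrence *)

Section PolynomialRecursion.
Variables (R : realType) (alpha beta : nat -> R).
Hypothesis beta_gt0 : forall k, 0 < beta k.
Hypothesis K_trace : trace_class_perturbation alpha beta.
Variable H : nat -> {poly R}.
(* The three-term recurrence at (z + 1/z)/2 for H k = (1 - z^2) z^k P k. *)
Hypothesis HS : forall k, beta k.+1 *: H k.+2 =
  (2^-1 *: (1 + 'X^2) - alpha k.+1 *: 'X) * H k.+1 - beta k *: ('X^2 * H k).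

(** Scaling the increment by [beta k] makes its multiplier exactly ['X^2]; all remaining
    coefficients vanish in the free case and are summable in general. *)
Lemma scaled_increment_rec k :
  beta k.+1 *: (H k.+2 - H k.+1) = 'X^2 * (beta k *: (H k.+1 - H k))
    + ((2^-1 - beta k.+1) *: H k.+1 + ((2^-1 - beta k) *: ('X^2 * H k.+1)
    + (- alpha k.+1) *: ('X^1 * H k.+1))).
Proof.
rewrite scalerBr HS expr1 -!mul_polyC !(polyCN, polyCB).
ring.
Qed.

(** One convergent sequence [N] serves all degrees [j] at once, which later makes the convergence of
    coefficients uniform in [j] after weighting. *)
Lemma coef_increment_bound (rho : R) : 0 <= rho < 1 ->
  exists N : nat -> R, [/\ cvgn N,
    forall j, `|(H 0)`_j| * rho ^+ j <= N 0%N
    & forall k j, `|(H k.+1)`_j - (H k)`_j| * rho ^+ j <= N k.+1 - N k].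
Proof.
move=> /andP[r0 r1].
have [g g0 gb] := trace_class_inv_bounded beta_gt0 K_trace.
pose D k := beta k *: (H k.+1 - H k).
have [M0 M0_ge0 HM0] := coef_bound_ex (H 0) r0.
have [M1 M1_ge0 DM1] := coef_bound_ex (D 0) r0.
pose e k := defect alpha beta k + defect alpha beta k.+1.
(* The first component bounds [H k] and the second the scaled increment [D k]. The second update
   uses the new first component because the error terms of [scaled_increment_rec] involve
   [H k.+1]. *)
pose NE := fix F k : R * R := if k is k'.+1 then
  let n := (F k').1 + g * (F k').2 in (n, rho ^+ 2 * (F k').2 + e k' * n)
  else (M0, M1).
pose N k := (NE k).1; pose E k := (NE k).2.
have e0 k : 0 <= e k by rewrite addr_ge0 ?defect_ge0.
have r2 : 0 <= rho ^+ 2 < 1 by rewrite exprn_ge0//= expr_lt1.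
have [N_ge0 E_ge0 Nc] := @summable_coupled_bound _ e g (rho ^+ 2) N E e0
  (defect_summable2 K_trace) (ltW g0) r2 M0_ge0 M1_ge0 (fun=> erefl) (fun=> erefl).
have incr k : coef_bound rho (D k) (E k) ->
    forall j, `|(H k.+1)`_j - (H k)`_j| * rho ^+ j <= N k.+1 - N k.
  move=> DE j.
  have -> : (H k.+1)`_j - (H k)`_j = ((beta k)^-1 *: D k)`_j.
    by rewrite /D scalerA mulVf ?gt_eqF// scale1r coefB.
  have -> : N k.+1 - N k = g * E k by rewrite /N /= addrC addKr.
  have Zb := coef_boundZ (beta k)^-1 DE; apply: (le_trans (Zb j)).
  by rewrite ler_wpM2r// gtr0_norm ?invr_gt0.
have HD k : coef_bound rho (H k) (N k) /\ coef_bound rho (D k) (E k).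
  elim: k => [//|k [HN DE]].
  have HN1 : coef_bound rho (H k.+1) (N k.+1).
    move=> j; have := incr k DE j; have := HN j.
    have : `|(H k.+1)`_j| * rho ^+ j <= `|(H k)`_j| * rho ^+ j +
        `|(H k.+1)`_j - (H k)`_j| * rho ^+ j.
      rewrite -mulrDl ler_wpM2r ?exprn_ge0//.
      by rewrite -{1}[(H k.+1)`_j](addrNK (H k)`_j) addrC ler_normD.
    by lra.
  split => //; rewrite /D scaled_increment_rec.
  have N1 := N_ge0 k.+1.
  have [X2 X1] : rho ^+ 2 * N k.+1 <= N k.+1 /\ rho ^+ 1 * N k.+1 <= N k.+1.
    by have r1' := ltW r1; split; rewrite ler_piMl// exprn_ile1.
  apply: coef_bound_le; last first.
    apply: coef_boundD => //; first exact: coef_boundXn (E_ge0 k) DE.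
    apply: coef_boundD => //; first exact: coef_boundZ HN1.
    apply: coef_boundD => //; [apply: coef_boundZ|apply: coef_boundZ].
      by apply: coef_bound_le X2 _; exact: coef_boundXn.
    by apply: coef_bound_le X1 _; exact: coef_boundXn.
  rewrite [E k.+1]/(rho ^+ 2 * E k + e k * N k.+1) lerD2l.
  rewrite normrN -!mulrDl ler_wpM2r// /e /defect !(distrC (2^-1)).
  by have := normr_ge0 (alpha k); lra.
exists N; split => // k j.
exact: incr (HD k).2 j.
Qed.

End PolynomialRecursion.

(** * Evaluation of real polynomials at complex points *)

Section ComplexEvaluation.
Variable R : realType.
Implicit Types (p : {poly R}) (z : R[i]).

Definition evalC p z : R[i] := (map_poly (real_complex R) p).[z].

Lemma evalC_wide p z n : (size p <= n)%N ->
  evalC p z = \sum_(j < n) (p`_j)%:C * z ^+ j.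
Proof.
move=> pn; rewrite /evalC (@horner_coef_wide _ n) ?size_map_poly//.
by apply: eq_bigr => j _; rewrite coef_map.
Qed.

Lemma geometric_partial_sum_le (q : R) n : 0 <= q < 1 ->
  \sum_(j < n) q ^+ j <= (1 - q)^-1.
Proof.
move=> /andP[q0 q1].
have q1' : 0 < 1 - q by rewrite subr_gt0.
rewrite -(ler_pM2l q1') divff ?gt_eqF//.
have -> : (1 - q) * \sum_(j < n) q ^+ j = 1 - q ^+ n.
  elim: n => [|n IH]; first by rewrite big_ord0 expr0 mulr0 subrr.
  by rewrite big_ord_recr/= mulrDr IH exprS; ring.
by rewrite gerBl exprn_ge0.
Qed.

(** The term of index [j] is at most [M * (modc z / rho) ^+ j], a geometric term of ratio below
    1. *)
Lemma modc_coef_sum_le (u : nat -> R) (rho M : R) z n : 0 <= M ->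
  modc z < rho -> (forall j, `|u j| * rho ^+ j <= M) ->
  modc (\sum_(j < n) (u j)%:C * z ^+ j) <= M * (1 - modc z / rho)^-1.
Proof.
move=> M0 zr uM; have r0 : 0 < rho := le_lt_trans (modc_ge0 z) zr.
apply: (le_trans (modc_sum n (fun j => (u j)%:C * z ^+ j))).
apply: (@le_trans _ _ (\sum_(j < n) M * (modc z / rho) ^+ j)).
  apply: ler_sum => j _; rewrite modcM modc_real modcX expr_div_n mulrA.
  rewrite ler_pdivlMr ?exprn_gt0// mulrAC.
  by rewrite ler_wpM2r ?exprn_ge0 ?modc_ge0.
rewrite -mulr_sumr ler_wpM2l// geometric_partial_sum_le//.
by rewrite divr_ge0 ?modc_ge0 ?ltW//= ltr_pdivrMr// mul1r.
Qed.

Lemma modc_sub_lim_le (u : nat -> R[i]) (l x : R[i]) (M : R) N :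
  (u : nat -> (R[i])^o) @ \oo --> (l : (R[i])^o) ->
  (forall n, (N <= n)%N -> modc (x - u n) <= M) -> modc (x - l) <= M.
Proof.
move=> /cvg_modcP/cvgrPdist_lt ul uM; apply/ler_addgt0Pr => e e0.
have [n0 _ hn] := ul _ e0.
have := hn (maxn n0 N) (leq_maxl _ _).
rewrite /= sub0r normrN ger0_norm ?modc_ge0// => h.
have -> : x - l = (x - u (maxn n0 N)) + (u (maxn n0 N) - l) by ring.
by rewrite (le_trans (modcD _ _))// lerD ?uM ?leq_maxr// ltW.
Qed.

End ComplexEvaluation.

(** * From uniform coefficient bounds to limits on the open disc *)

Section PolynomialLimit.
Variables (R : realType) (H : nat -> {poly R}).
Hypothesis H_incr : forall rho : R, 0 <= rho < 1 ->
  exists N : nat -> R, [/\ cvgn N,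
    forall j, `|(H 0)`_j| * rho ^+ j <= N 0%N
    & forall k j, `|(H k.+1)`_j - (H k)`_j| * rho ^+ j <= N k.+1 - N k].

Lemma coef_cvg j : cvgn (fun k => (H k)`_j).
Proof.
(* Any radius strictly between 0 and 1 works: for fixed [j] the weight is a positive constant. *)
have half : 0 <= (2^-1 : R) < 1 by lra.
have [N [Nc _ HN]] := H_incr half.
have h0 : 0 < (2^-1 : R) ^+ j by rewrite exprn_gt0.
apply: (@telescope_cvg _ _ (fun k => N k / 2^-1 ^+ j)).
  by move=> k; rewrite -mulrBl ler_pdivlMr.
by apply: is_cvgMl.
Qed.

Definition coef_lim j : R := limn (fun k => (H k)`_j).

(** Adding increments from [k] to [m] gives the bound [N m - N k]; letting [m] tend to infinity
    leaves [limn N - N k], which does not depend on [j]. *)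
Lemma coef_lim_dist (rho : R) : 0 < rho < 1 -> exists d : nat -> R,
  [/\ d @ \oo --> (0 : R), forall k, 0 <= d k
    & forall k j, `|(H k)`_j - coef_lim j| * rho ^+ j <= d k].
Proof.
move=> /andP[r0 r1]; have r0' := ltW r0.
have [|N [Nc _ HN]] := H_incr (rho := rho); first by rewrite r0'.
have nd : nondecreasing_seq N.
  apply/nondecreasing_seqP => k; rewrite -subr_ge0.
  by apply: le_trans (HN k 0%N); rewrite mulr_ge0// exprn_ge0// ltW.
exists (fun k => limn N - N k); split => [|k|k j].
- by rewrite -(subrr (limn N)); apply: cvgB => //; exact: cvg_cst.
- by rewrite subr_ge0; exact: nondecreasing_cvgn_le.
have dist m : (k <= m)%N ->
    `|(H k)`_j - (H m)`_j| * rho ^+ j <= N m - N k.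
  elim: m => [|m IH].
    by rewrite leqn0 => /eqP ->; rewrite !subrr normr0 mul0r.
  rewrite leq_eqVlt => /orP[/eqP ->|]; first by rewrite !subrr normr0 mul0r.
  rewrite ltnS => /IH hm; have := HN m j; rewrite distrC => hs.
  apply: (@le_trans _ _ ((`|(H k)`_j - (H m)`_j| + `|(H m)`_j - (H m.+1)`_j|)
      * rho ^+ j)).
    rewrite ler_wpM2r ?exprn_ge0//.
    exact: ler_distD.
  by rewrite mulrDl; lra.
have c1 : (fun m => `|(H k)`_j - (H m)`_j| * rho ^+ j) @ \oo -->
    `|(H k)`_j - coef_lim j| * rho ^+ j.
  apply: cvgMl; apply: cvg_norm; apply: cvgB; [exact: cvg_cst|].
  exact: coef_cvg.
have c2 : (fun m => N m - N k) @ \oo --> limn N - N k.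
  by apply: cvgB => //; exact: cvg_cst.
rewrite -(cvg_lim (@Rhausdorff _) c1) -(cvg_lim (@Rhausdorff _) c2).
apply: ler_lim; [exact: cvgP c1|exact: cvgP c2|].
by exists k => // m /= /dist.
Qed.

Lemma coef_lim_bounded (rho : R) : 0 < rho < 1 ->
  exists2 M, 0 <= M & forall j, `|coef_lim j| * rho ^+ j <= M.
Proof.
move=> r; have [d [_ d0 hd]] := coef_lim_dist r.
have r0 : 0 <= rho by case/andP: r => /ltW.
have [M M0 HM] := coef_bound_ex (H 0) r0.
exists (M + d 0%N); first exact: addr_ge0.
move=> j; have := HM j; have := hd 0%N j.
have : `|coef_lim j| * rho ^+ j <= `|(H 0)`_j| * rho ^+ j +
    `|(H 0)`_j - coef_lim j| * rho ^+ j.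
  rewrite -mulrDl ler_wpM2r ?exprn_ge0// (distrC (H 0)`_j).
  by rewrite -{1}[coef_lim j](addrNK (H 0)`_j) addrC ler_normD.
by lra.
Qed.

(** The midpoint of [modc z] and 1 is the radius [rho] used at the point [z]. *)
Lemma modc_between (z : R[i]) : modc z < 1 ->
  0 < (1 + modc z) / 2 < 1 /\ modc z < (1 + modc z) / 2.
Proof. by have := modc_ge0 z; lra. Qed.

Lemma coef_lim_series_cvg (z : R[i]) : modc z < 1 ->
  cvgn (series (fun j => (coef_lim j)%:C * z ^+ j : (R[i])^o)).
Proof.
move=> /modc_between[r zr]; have [M M0 hM] := coef_lim_bounded r.
set rho := (1 + _) / 2 in r zr hM.
apply: cvg_series_modc; apply: nondecreasing_is_cvgn.
  by apply: nondecreasing_series => k _ _; exact: modc_ge0.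
exists (M * (1 - modc z / rho)^-1) => _ [n _ <-].
(* Applied to absolute values at the real point [modc z], the estimate bounds the sum of the moduli
   and not merely the modulus of the sum. *)
have := @modc_coef_sum_le _ (fun j => `|coef_lim j|) rho M (modc z)%:C n M0.
rewrite modc_real ger0_norm ?modc_ge0// => /(_ zr).
have h : forall j, `| `|coef_lim j| | * rho ^+ j <= M.
  by move=> j; rewrite normr_id.
move=> /(_ h); apply: le_trans; rewrite /series/= big_mkord.
have -> : \sum_(j < n) (`|coef_lim j|)%:C * (modc z)%:C ^+ j =
    (\sum_(j < n) modc ((coef_lim j)%:C * z ^+ j))%:C.
  rewrite rmorph_sum; apply: eq_bigr => j _.
  by rewrite modcM modc_real modcX rmorphM rmorphXn.
by rewrite modc_real ler_norm.
Qed.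

Lemma evalC_cvg (z : R[i]) : modc z < 1 ->
  (fun k => evalC (H k) z : (R[i])^o) @ \oo -->
  limn (series (fun j => (coef_lim j)%:C * z ^+ j : (R[i])^o)).
Proof.
move=> z1; have [r zr] := modc_between z1.
set rho := (1 + _) / 2 in r zr.
have [d [d0 d_ge0 hd]] := coef_lim_dist r.
have sc := coef_lim_series_cvg z1.
set l := limn _ in sc *.
apply/cvg_modcP; apply: (@squeeze_cvgr _ _ _ _ (cst 0)
    (fun k => d k * (1 - modc z / rho)^-1)).
- apply: nearW => k; rewrite modc_ge0/=.
  (* From [n = size (H k)] on, the value of [H k] is a sum of [n] terms and can be compared termwise
     with the partial sum of the series. *)
  apply: (modc_sub_lim_le sc (N := size (H k))) => n sn.
  rewrite (evalC_wide _ sn) /series/= big_mkord -sumrB.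
  rewrite (eq_bigr (fun j : 'I_n => (((H k)`_j - coef_lim j)%:C * z ^+ j))).
    exact: (@modc_coef_sum_le _ (fun j => (H k)`_j - coef_lim j) rho (d k) z n
      (d_ge0 k) zr (hd k)).
  by move=> j _; rewrite rmorphB mulrBl.
- exact: cvg_cst.
- by rewrite -(mul0r (1 - modc z / rho)^-1); apply: cvgMl.
Qed.

End PolynomialLimit.

(** * Chebyshev polynomials at (x + 1/x)/2, over any field that receives [R]; both [R] itself and
    [R[i]] are used *)

Section JoukowskiEvaluation.
Variables (R : realType) (F : fieldType) (f : {rmorphism R -> F}).
Implicit Types (x : F) (p : {poly R}).

Local Notation "p ^f" := (map_poly f p).
Local Notation lam x := (2^-1 * (x + x^-1)).

Lemma chebyshevUSS k :
  chebyshevU R k.+2 = 2 *: ('X * chebyshevU R k.+1) - chebyshevU R k.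
Proof.
have two0 : (2 : R) != 0 by rewrite pnatr_eq0.
have -> : chebyshevU R k.+2 = (2^-1)^-1 *:
  (('X - 0%:P) * chebyshevU R k.+1 - 2^-1 *: chebyshevU R k) by [].
by rewrite polyC0 subr0 invrK scalerBr scalerA divff// scale1r.
Qed.

(** This is sin((i+1)t)/sin t with x = exp(it), cleared of denominators so that it also holds for x
    = 1 and x = -1. *)
Lemma chebyshevU_joukowski x i : x != 0 ->
  (1 - x ^+ 2) * (x ^+ i * (chebyshevU R i)^f.[lam x]) = 1 - x ^+ (i + i + 2).
Proof.
move=> x0.
have two0 : (2 : F) != 0 by rewrite -(rmorph_nat f) fmorph_eq0 pnatr_eq0.
(* The recurrence has order two, so the induction carries two consecutive indices. *)
suff [] : (1 - x ^+ 2) * (x ^+ i * (chebyshevU R i)^f.[lam x]) =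
    1 - x ^+ (i + i + 2) /\
  (1 - x ^+ 2) * (x ^+ i.+1 * (chebyshevU R i.+1)^f.[lam x]) =
    1 - x ^+ (i + i + 4) by [].
elim: i => [|i [IH1 IH2]]; split.
- by rewrite /chebyshevU/= rmorph1 hornerC expr0 !mulr1.
- rewrite /chebyshevU/= /free_alpha /free_beta polyC0 !subr0 invrK mulr1.
  rewrite map_polyZ map_polyX hornerZ hornerX rmorph_nat.
  by field; rewrite x0.
- by rewrite IH2 addnS addSn addnS !addnS.
rewrite chebyshevUSS rmorphB/= map_polyZ rmorphM/= map_polyX rmorph_nat.
rewrite hornerD hornerN hornerZ hornerM hornerX.
have -> : (1 - x ^+ 2) * (x ^+ i.+2 * (2 * (lam x * (chebyshevU R i.+1)^f.[lam x])
     - (chebyshevU R i)^f.[lam x])) =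
  (x ^+ 2 + 1) * ((1 - x ^+ 2) * (x ^+ i.+1 * (chebyshevU R i.+1)^f.[lam x]))
  - x ^+ 2 * ((1 - x ^+ 2) * (x ^+ i * (chebyshevU R i)^f.[lam x])).
  by rewrite !exprS; field; rewrite x0.
have -> : (i.+1 + i.+1 + 4 = (i + i) + 6)%N by rewrite addSn !addnS.
by rewrite IH1 IH2 !(exprD x (i + i)); ring.
Qed.

(** The [H k] of the overview, expanded by [chebyshevU_joukowski] into a genuine polynomial. The
    subtracted monomials have degree at least [k + 2], so the coefficients up to degree [k] are
    entries of [c]. *)
Definition connection_poly (c : nat -> nat -> R) k : {poly R} :=
  \sum_(i < k.+1) c i k *: ('X^(k - i) - 'X^(k + i + 2)).

Lemma connection_poly_joukowski P c x k : connection_matrix P c -> x != 0 ->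
  (connection_poly c k)^f.[x] = (1 - x ^+ 2) * (x ^+ k * (P k)^f.[lam x]).
Proof.
move=> [_ Pc] x0; rewrite Pc /connection_poly !rmorph_sum/= !horner_sum.
rewrite !mulr_sumr; apply: eq_bigr => -[i ik] _ /=.
rewrite !map_polyZ rmorphB/= !map_polyXn !hornerZ hornerD hornerN !hornerXn.
have ik' : (i <= k)%N by [].
have -> : x ^+ k = x ^+ (k - i) * x ^+ i by rewrite -exprD subnK.
transitivity (f (c i k) * (x ^+ (k - i) * (1 - x ^+ (i + i + 2)))).
  by congr (_ * _); rewrite mulrBr mulr1 -exprD !addnA subnK.
by rewrite -(chebyshevU_joukowski i x0); ring.
Qed.

End JoukowskiEvaluation.

(** * Toeplitz symbols as limits of scaled polynomials *)

Section ConnectionSymbol.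
Variables (R : realType) (alpha beta : nat -> R).
Hypothesis beta_gt0 : forall k, 0 < beta k.
Hypothesis K_trace : trace_class_perturbation alpha beta.

(** Row 0 is left out: [assocpoly] satisfies it only up to a source term 1, so this form covers both
    families. *)
Definition jacobi_recurrence (P : nat -> {poly R}) := forall k,
  'X * P k.+1 =
    beta k *: P k + alpha k.+1 *: P k.+1 + beta k.+1 *: P k.+2.

Lemma orthopoly_recurrence : jacobi_recurrence (orthopoly alpha beta).
Proof.
move=> k; set P := orthopoly alpha beta.
have -> : P k.+2 = (beta k.+1)^-1 *:
  (('X - (alpha k.+1)%:P) * P k.+1 - beta k *: P k) by [].
move: (P k.+1) (P k) => p q.
by rewrite scalerA divff ?gt_eqF// scale1r mulrBl mul_polyC; ring.
Qed.

Lemma assocpoly_recurrence : jacobi_recurrence (assocpoly alpha beta).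
Proof.
move=> k; set P := assocpoly alpha beta.
have -> : P k.+2 = (beta k.+1)^-1 *:
  (('X - (alpha k.+1)%:P) * P k.+1 - beta k *: P k) by [].
move: (P k.+1) (P k) => p q.
by rewrite scalerA divff ?gt_eqF// scale1r mulrBl mul_polyC; ring.
Qed.

(** Otherwise the points 1, ..., n, where n is the size of [p - q], would be more roots than its
    degree allows. *)
Lemma poly_eq_nonzero (p q : {poly R}) :
  (forall x, x != 0 -> p.[x] = q.[x]) -> p = q.
Proof.
move=> pq; apply/eqP; rewrite -subr_eq0; apply/negP => /negP r0.
have := @max_poly_roots _ _ [seq i.+1%:R | i <- iota 0 (size (p - q))] r0.
rewrite size_map size_iota ltnn => h.
suff : false by []; apply: h.
  apply/allP => _ /mapP[i _ ->].
  by rewrite rootE hornerD hornerN pq ?subrr// pnatr_eq0.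
rewrite map_inj_uniq ?iota_uniq// => i j /eqP.
by rewrite eqr_nat eqSS => /eqP.
Qed.

Variables (P : nat -> {poly R}) (c : nat -> nat -> R).
Hypothesis P_rec : jacobi_recurrence P.
Hypothesis Pc : connection_matrix P c.

Local Notation H := (connection_poly c).

Lemma coef_connection_poly k j : (j <= k)%N -> (H k)`_j = c (k - j)%N k.
Proof.
move=> jk; rewrite coef_sum.
have jlt i : (j < k + i + 2)%N by rewrite addn2 ltnS -addnS (leq_trans jk) ?leq_addr.
have kj : (k - j < k.+1)%N by rewrite ltnS leq_subr.
rewrite (bigD1 (Ordinal kj))//= big1 ?addr0.
  rewrite coefZ coefB !coefXn subKn// eqxx.
  by rewrite ltn_eqF// subr0 mulr1.
move=> i ij; rewrite coefZ coefB !coefXn.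
rewrite [_ == (k + i + 2)%N]ltn_eqF// subr0; case: eqP => [ji|]; last by rewrite mulr0.
case/eqP: ij; apply: val_inj => /=.
by rewrite ji subKn// -ltnS.
Qed.

(** The identity is checked at nonzero real points, where it is the recurrence of [P] multiplied by
    (1 - x^2) x^(k+2). *)
Lemma connection_poly_rec k : beta k.+1 *: H k.+2 =
  (2^-1 *: (1 + 'X^2) - alpha k.+1 *: 'X) * H k.+1 - beta k *: ('X^2 * H k).
Proof.
apply: poly_eq_nonzero => x x0.
have Hx n : (H n).[x] =
    (1 - x ^+ 2) * (x ^+ n * (P n).[2^-1 * (x + x^-1)]).
  have := @connection_poly_joukowski R R idfun P c x n Pc x0.
  by rewrite !map_poly_id.
have := congr1 (fun p => p.[2^-1 * (x + x^-1)]) (P_rec k).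
rewrite !(hornerD, hornerN, hornerZ, hornerM, hornerXn, hornerX, hornerC) !Hx.
set u := (P k).[_]; set v := (P k.+1).[_]; set w := (P k.+2).[_] => e.
have -> : beta k.+1 * ((1 - x ^+ 2) * (x ^+ k.+2 * w)) =
    (1 - x ^+ 2) * x ^+ k.+2 * (beta k.+1 * w) by ring.
have -> : beta k.+1 * w =
    2^-1 * (x + x^-1) * v - beta k * u - alpha k.+1 * v by rewrite e; ring.
by rewrite !exprS; field.
Qed.

Let H_incr := coef_increment_bound beta_gt0 K_trace connection_poly_rec.

(** The entries along the [j]-th diagonal are the coefficients of degree [j] of the polynomials
    [H (i + j)]. *)
Lemma connection_diag_cvg j :
  (fun i => c i (i + j)%N) @ \oo --> coef_lim H j.
Proof.
have -> : (fun i => c i (i + j)%N) = (fun i => (H (i + j)%N)`_j).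
  by apply/funext => i; rewrite coef_connection_poly ?leq_addl// addnK.
by rewrite (cvg_shiftn j (fun k => (H k)`_j)); exact: coef_cvg H_incr j.
Qed.

Lemma toeplitz_coefE j : toeplitz_coef c j = coef_lim H j.
Proof. exact: (cvg_lim (@Rhausdorff R) (@connection_diag_cvg j)). Qed.

Lemma connection_has_symbol : has_toeplitz_symbol c.
Proof.
split=> [j|z]; first exact: cvgP (@connection_diag_cvg j).
rewrite normr_lt1_modc => z1.
under eq_fun do rewrite toeplitz_coefE.
exact: coef_lim_series_cvg H_incr z z1.
Qed.

Lemma connection_symbol_cvg (z : R[i]) : modc z < 1 -> z != 0 ->
  (fun k => (1 - z ^+ 2) * (z ^+ k * evalC (P k) (joukowski z)) : (R[i])^o)
    @ \oo --> (toeplitz_symbol c z : (R[i])^o).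
Proof.
move=> z1 z0; rewrite /toeplitz_symbol.
under [X in limn (series X)]eq_fun do rewrite toeplitz_coefE.
have -> : (fun k => (1 - z ^+ 2) * (z ^+ k * evalC (P k) (joukowski z))) =
    (fun k => evalC (H k) z).
  by apply/funext => k; rewrite /evalC (connection_poly_joukowski _ _ Pc z0).
exact: evalC_cvg H_incr z z1.
Qed.

End ConnectionSymbol.

(** * Growing and decaying components of solutions of the recurrence *)

Section Asymptotics.
Variables (R : realType) (alpha beta : nat -> R).
Hypothesis beta_gt0 : forall k, 0 < beta k.
Hypothesis K_trace : trace_class_perturbation alpha beta.

(** Only the rows from 1 on are imposed, so the solutions form a two-dimensional space. *)
Definition formal_solution (lam : R[i]) (w : nat -> R[i]) := forall k,
  lam * w k.+1 = (beta k)%:C * w k + (alpha k.+1)%:C * w k.+1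
    + (beta k.+1)%:C * w k.+2.

(** As no [beta k] vanishes, the recurrence runs both ways: down from [N] to 0, then up. *)
Lemma formal_solution_eq0 lam w N : formal_solution lam w ->
  w N = 0 -> w N.+1 = 0 -> forall k, w k = 0.
Proof.
move=> ws; have bC k : (beta k)%:C != 0 :> R[i].
  by rewrite -modc_eq0 modc_real normr_eq0 gt_eqF.
have up n : w n = 0 -> w n.+1 = 0 -> w n.+2 = 0.
  move=> w0 w1; have := ws n; rewrite w0 w1 !mulr0 !add0r => /esym/eqP.
  by rewrite mulf_eq0 (negbTE (bC _)) => /eqP.
have down n : w n.+1 = 0 -> w n.+2 = 0 -> w n = 0.
  move=> w0 w1; have := ws n; rewrite w0 w1 !mulr0 !addr0 => /esym/eqP.
  by rewrite mulf_eq0 (negbTE (bC _)) => /eqP.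
move=> wN wN1.
have [w0 w1] : w 0%N = 0 /\ w 1%N = 0.
  elim: N wN wN1 => // n IH w1 w2; apply: IH => //; exact: down.
move=> k; suff [] : w k = 0 /\ w k.+1 = 0 by [].
by elim: k => // k [h0 h1]; split => //; exact: up.
Qed.

Variable z : R[i].
Hypothesis z_neq0 : z != 0.
Hypothesis z_le1 : modc z <= 1.
Hypothesis z2_neq1 : z ^+ 2 != 1.

(* In the free case [growing w] is constant and [decaying w k] is proportional
   to z^(2k); they are multiples of the coefficients of w along z^(-k) and
   z^k. *)
Definition growing (w : nat -> R[i]) k : R[i] :=
  z ^+ k * (2 * (beta k)%:C * w k.+1 - z * w k).
Definition decaying (w : nat -> R[i]) k : R[i] :=
  z ^+ k * (2 * (beta k)%:C * z * w k.+1 - w k).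

Let size w k : R := modc (growing w k) + modc (decaying w k).

Lemma size_ge0 w k : 0 <= size w k.
Proof. by rewrite addr_ge0 ?modc_ge0. Qed.

(** The error coefficients vanish in the free case, as do those in [decayingS]; they are of the
    order of the defects in rows [k] and [k.+1]. *)
Lemma growingS w k : formal_solution (joukowski z) w ->
  growing w k.+1 = growing w k +
    ((1 - 2 * (beta k)%:C - 2 * (alpha k.+1)%:C * z) * (z ^+ k * w k.+1) +
     (1 - 2 * (beta k)%:C) * (z * (z ^+ k * w k))).
Proof.
move=> /(_ k); rewrite /growing /joukowski => e.
have -> : 2 * (beta k.+1)%:C * w k.+2 = 2 * ((beta k.+1)%:C * w k.+2) by ring.
have -> : (beta k.+1)%:C * w k.+2 = 2^-1 * (z + z^-1) * w k.+1 -
  (beta k)%:C * w k - (alpha k.+1)%:C * w k.+1 by rewrite e; ring.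
by rewrite exprS; field.
Qed.

Lemma decayingS w k : formal_solution (joukowski z) w ->
  decaying w k.+1 = z ^+ 2 * decaying w k +
    z ^+ 2 * (((1 - 2 * (beta k)%:C) * z - 2 * (alpha k.+1)%:C)
                * (z ^+ k * w k.+1) +
      (1 - 2 * (beta k)%:C) * (z ^+ k * w k)).
Proof.
move=> /(_ k); rewrite /decaying /joukowski => e.
have -> : 2 * (beta k.+1)%:C * z * w k.+2 = 2 * z * ((beta k.+1)%:C * w k.+2).
  by ring.
have -> : (beta k.+1)%:C * w k.+2 = 2^-1 * (z + z^-1) * w k.+1 -
  (beta k)%:C * w k - (alpha k.+1)%:C * w k.+1 by rewrite e; ring.
by rewrite exprS; field.
Qed.

Let delta k := defect alpha beta k + defect alpha beta k.+1.

Lemma delta_ge0 k : 0 <= delta k.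
Proof. by rewrite addr_ge0 ?defect_ge0. Qed.

Lemma one_sub_2beta k : modc (1 - 2 * (beta k)%:C) <= 2 * delta k.
Proof.
have -> : 1 - 2 * (beta k)%:C = (1 - 2 * beta k)%:C :> R[i].
  by rewrite rmorphB rmorph1 rmorphM rmorph_nat.
rewrite modc_real (_ : 1 - _ = 2 * (2^-1 - beta k)); last by field.
rewrite normrM ger0_norm// ler_wpM2l// distrC /delta /defect.
by have := normr_ge0 (alpha k); have := normr_ge0 (alpha k.+1);
  have := normr_ge0 (beta k.+1 - 2^-1); lra.
Qed.

Lemma two_alphaS k : modc (2 * (alpha k.+1)%:C) <= 2 * delta k.
Proof.
have -> : 2 * (alpha k.+1)%:C = (2 * alpha k.+1)%:C :> R[i].
  by rewrite rmorphM rmorph_nat.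
rewrite modc_real normrM ger0_norm// ler_wpM2l// /delta /defect.
by have := normr_ge0 (alpha k); have := normr_ge0 (beta k - 2^-1);
  have := normr_ge0 (beta k.+1 - 2^-1); lra.
Qed.

Lemma modc_1z2_gt0 : 0 < modc (1 - z ^+ 2).
Proof. by rewrite modc_gt0 subr_eq0 eq_sym. Qed.

(** The combination [z * growing w k - decaying w k] equals (1 - z^2) z^k w k, which recovers [w k]
    because z^2 differs from 1; then [growing] gives [w k.+1] after division by [2 * beta k]. *)
Lemma solution_le_size : exists2 C : R, 0 < C & forall w k,
  modc (z ^+ k * w k) + modc (z ^+ k * w k.+1) <= C * size w k.
Proof.
have [g g0 gb] := trace_class_inv_bounded beta_gt0 K_trace.
have g0' := ltW g0; have d0 := modc_1z2_gt0; set d := modc _ in d0.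
have di0 : 0 < d^-1 by rewrite invr_gt0.
exists (d^-1 + g * (1 + d^-1)).
  by rewrite addr_gt0// mulr_gt0// addr_gt0.
move=> w k; set x := modc (z ^+ k * w k); set y := modc (z ^+ k * w k.+1).
have hx : x <= d^-1 * size w k.
  rewrite mulrC ler_pdivlMr// /x /d -modcM.
  have -> : z ^+ k * w k * (1 - z ^+ 2) = z * growing w k - decaying w k.
    by rewrite /growing /decaying; ring.
  by rewrite (le_trans (modcB _ _))// lerD2r modcM ler_piMl// modc_ge0.
have hy : y <= g * (size w k + x).
  apply: (@le_trans _ _ ((beta k)^-1 * (beta k * y))).
    by rewrite mulrA mulVf ?mul1r// gt_eqF.
  have by0 : 0 <= beta k * y by rewrite mulr_ge0 ?modc_ge0// ltW.
  apply: (@le_trans _ _ (g * (beta k * y))); first by rewrite ler_wpM2r.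
  rewrite ler_wpM2l//.
  apply: (@le_trans _ _ (2 * (beta k * y))); first by lra.
  have -> : 2 * (beta k * y) = modc (growing w k + z * (z ^+ k * w k)).
    have -> : growing w k + z * (z ^+ k * w k) =
        (2 * beta k)%:C * (z ^+ k * w k.+1).
      by rewrite /growing rmorphM rmorph_nat; ring.
    rewrite modcM modc_real ger0_norm; first by rewrite mulrA.
    by rewrite mulr_ge0// ltW.
  rewrite (le_trans (modcD _ _))// lerD//.
    by rewrite lerDl modc_ge0.
  by rewrite modcM ler_piMl// modc_ge0.
have S0 := size_ge0 w k.
apply: (le_trans (lerD hx hy)).
have : g * (size w k + x) <= g * (size w k + d^-1 * size w k).
  by rewrite ler_wpM2l// lerD2l.
by rewrite mulrDl; lra.
Qed.

Lemma growing_decaying_perturbed : exists eta : nat -> R,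
  [/\ forall k, 0 <= eta k, cvgn (series eta)
    & forall w, formal_solution (joukowski z) w -> forall k,
      modc (growing w k.+1 - growing w k) <= eta k * size w k /\
      modc (decaying w k.+1 - z ^+ 2 * decaying w k) <= eta k * size w k].
Proof.
have [C C0 hC] := solution_le_size.
(* The coefficient of [w k.+1] in the errors is at most [2 * delta k + 2 * delta k]; [C] converts
   the solution into its components. *)
exists (fun k => (4 * C) * delta k); split=> [k||w ws k].
- by rewrite !mulr_ge0 ?delta_ge0// ltW.
- exact: is_cvg_seriesZ (4 * C) (defect_summable2 K_trace).
have hb := one_sub_2beta k; have ha := two_alphaS k.
have d0 := delta_ge0 k; have hs := hC w k; have S0 := size_ge0 w k.
set x := modc (z ^+ k * w k) in hs; set y := modc (z ^+ k * w k.+1) in hs.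
have x0 : 0 <= x by exact: modc_ge0.
have y0 : 0 <= y by exact: modc_ge0.
have mz (r : R) : 0 <= r -> modc z * r <= r by move=> r0; rewrite ler_piMl.
have fin (r : R) : r <= 4 * delta k * y + 2 * delta k * x ->
    r <= 4 * C * delta k * size w k.
  move=> /le_trans; apply.
  have : delta k * (x + y) <= delta k * (C * size w k) by rewrite ler_wpM2l.
  have : 0 <= delta k * x by rewrite mulr_ge0.
  by nra.
split; apply: fin.
- rewrite (growingS k ws) addrC addKr (le_trans (modcD _ _))// lerD//.
    rewrite modcM ler_wpM2r// (le_trans (modcB _ _))// (modcM _ z) (mulrC (modc _)).
    have := mz _ (modc_ge0 (2 * (alpha k.+1)%:C)); lra.
  rewrite modcM (modcM z); apply: (@le_trans _ _ (modc (1 - 2 * (beta k)%:C) * x)).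
    by rewrite ler_wpM2l ?modc_ge0// mz.
  by rewrite ler_wpM2r.
- rewrite (decayingS k ws) addrC addKr.
  apply: (@le_trans _ _ (modc (((1 - 2 * (beta k)%:C) * z - 2 * (alpha k.+1)%:C)
                * (z ^+ k * w k.+1) + (1 - 2 * (beta k)%:C) * (z ^+ k * w k)))).
    by rewrite modcM ler_piMl ?modc_ge0// modcX exprn_ile1 ?modc_ge0.
  rewrite (le_trans (modcD _ _))// lerD//.
    rewrite modcM ler_wpM2r// (le_trans (modcB _ _))// (modcM _ z) (mulrC (modc _)).
    have := mz _ (modc_ge0 (1 - 2 * (beta k)%:C)); lra.
  by rewrite modcM ler_wpM2r.
Qed.

(** Both components are combinations of z^k w k and z^(k+1) w (k+1) with bounded coefficients. *)
Lemma growing_decaying_cvg0 w :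
  (fun k => modc (z ^+ k * w k)) @ \oo --> (0 : R) ->
  (fun k => modc (growing w k)) @ \oo --> (0 : R) /\
  (fun k => modc (decaying w k)) @ \oo --> (0 : R).
Proof.
set v := fun k => modc (z ^+ k * w k) => v0.
have v1 : (fun k => v k.+1) @ \oo --> (0 : R) by rewrite cvg_shiftS.
have bl := trace_class_beta_cvg K_trace.
have lim (s : R) : (fun k => 2 * beta k * s * v k.+1 + v k) @ \oo --> (0 : R).
  have -> : (0 : R) = 2 * 2^-1 * s * 0 + 0 by rewrite mulr0 addr0.
  apply: cvgD => //; apply: cvgM => //; apply: cvgMl; exact: cvgMr.
have bE k : modc (2 * (beta k)%:C) = 2 * beta k.
  have -> : 2 * (beta k)%:C = (2 * beta k)%:C :> R[i].
    by rewrite rmorphM rmorph_nat.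
  by rewrite modc_real ger0_norm// mulr_ge0// ltW.
split.
- apply: (squeeze_cvgr _ (cvg_cst 0) (lim (modc z^-1))).
  apply: nearW => k; rewrite modc_ge0/=.
  have -> : growing w k =
      2 * (beta k)%:C * z^-1 * (z ^+ k.+1 * w k.+1) - z * (z ^+ k * w k).
    by rewrite /growing exprS; field.
  rewrite (le_trans (modcB _ _))// lerD//; last by rewrite modcM ler_piMl ?modc_ge0.
  by rewrite modcM (modcM _ z^-1) bE.
- apply: (squeeze_cvgr _ (cvg_cst 0) (lim 1)).
  apply: nearW => k; rewrite modc_ge0/=.
  have -> : decaying w k =
      2 * (beta k)%:C * (z ^+ k.+1 * w k.+1) - z ^+ k * w k.
    by rewrite /decaying exprS; ring.
  by rewrite (le_trans (modcB _ _))// lerD// modcM bE mulr1.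
Qed.

Lemma cvg0_lower_bound (x : nat -> R) (y : R) N :
  x @ \oo --> (0 : R) -> (forall n, (N <= n)%N -> y <= x n) -> y <= 0.
Proof.
move=> x0 h; rewrite leNgt; apply/negP => y0.
have /cvgrPdist_lt/(_ _ y0)[n _ hn] := x0.
have := hn (maxn n N) (leq_maxl _ _); rewrite /= sub0r normrN.
rewrite ltNge => /negP; apply; apply: le_trans (ler_norm _).
by apply: h; rewrite leq_maxr.
Qed.

(* For |z| = 1 the size |growing| + |decaying| stays bounded below. *)
Lemma unit_circle_no_decay w : modc z = 1 ->
  formal_solution (joukowski z) w ->
  (w : nat -> (R[i])^o) @ \oo --> (0 : (R[i])^o) -> forall k, w k = 0.
Proof.
move=> zE ws /cvg0_modcP w0.
have [eta [eta0 eta_s pert]] := growing_decaying_perturbed.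
have [|A0 B0] := @growing_decaying_cvg0 w.
  have -> // : (fun k => modc (z ^+ k * w k)) = (fun k => modc (w k)).
  by apply/funext => k; rewrite modcM modcX zE expr1n mul1r.
have S0 : (fun k => size w k) @ \oo --> (0 : R).
  by rewrite -[0]addr0; exact: cvgD.
have eta2 : cvgn (series (fun k => 2 * eta k)) by exact: is_cvg_seriesZ.
have eta2_ge0 k : 0 <= 2 * eta k by rewrite mulr_ge0.
have half : 0 < (2^-1 : R) by rewrite invr_gt0.
have [N tail] := summable_tail eta2_ge0 eta2 half.
have SN : size w N <= 0.
  rewrite leNgt; apply/negP => SN.
  (* With |z| = 1 the factor z^2 preserves moduli, so only the errors of the two components, at most
     [eta k * size w k] each, can reduce the size. *)
  have step k : (N <= k)%N -> (1 - 2 * eta k) * size w k <= size w k.+1.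
    move=> _; have [hA hB] := pert w ws k.
    have : modc (growing w k) <=
        modc (growing w k.+1) + modc (growing w k.+1 - growing w k).
      rewrite -{1}[growing w k](subKr (growing w k.+1)).
      exact: modcB.
    have : modc (decaying w k) <=
        modc (decaying w k.+1) + modc (decaying w k.+1 - z ^+ 2 * decaying w k).
      have -> : modc (decaying w k) = modc (z ^+ 2 * decaying w k).
        by rewrite modcM modcX zE expr1n mul1r.
      rewrite -{1}[z ^+ 2 * _](subKr (decaying w k.+1)).
      exact: modcB.
    by rewrite /size in hA hB *; lra.
  have lb := @summable_lower_bound _ _ (size w) N eta2_ge0 tail SN step.
  have := cvg0_lower_bound S0 lb; lra.
have d0 := modc_1z2_gt0.
have [C C0 hC] := solution_le_size.
have h : modc (z ^+ N * w N) + modc (z ^+ N * w N.+1) <= 0.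
  by apply: (le_trans (hC w N)); rewrite mulr_ge0_le0// ltW.
have zN x : modc (z ^+ N * x) = modc x by rewrite modcM modcX zE expr1n mul1r.
rewrite !zN in h; have := modc_ge0 (w N); have := modc_ge0 (w N.+1) => h1 h0.
apply: (@formal_solution_eq0 (joukowski z) w N ws); apply/eqP; rewrite -modc_eq0.
  by apply/eqP; lra.
by apply/eqP; lra.
Qed.

(* The cone |decaying| <= |growing| is eventually invariant, and |growing| is
   bounded below inside it. *)
Lemma disc_cone : modc z < 1 -> exists N, forall w,
  formal_solution (joukowski z) w -> decaying w N = 0 ->
  (fun k => modc (z ^+ k * w k)) @ \oo --> (0 : R) -> growing w N = 0.
Proof.
move=> z1; have [eta [eta0 eta_s pert]] := growing_decaying_perturbed.
have eta2 : cvgn (series (fun k => 2 * eta k)) by exact: is_cvg_seriesZ.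
have eta2_ge0 k : 0 <= 2 * eta k by rewrite mulr_ge0.
have q1 : modc z ^+ 2 < 1 by rewrite expr_lt1// modc_ge0.
(* With [q = modc z ^+ 2], the bound [2 * eta k <= (1 - q) / 2] gives
   [q + 2 * eta k <= 1 - 2 * eta k], which keeps the cone invariant; it is also at most 1/2, as
   [summable_lower_bound] requires. *)
have d0 : 0 < (1 - modc z ^+ 2) / 2 by rewrite divr_gt0// subr_gt0.
have [N tail] := summable_tail eta2_ge0 eta2 d0.
have q0 : 0 <= modc z ^+ 2 by rewrite exprn_ge0// modc_ge0.
set q := modc z ^+ 2 in q1 d0 tail q0.
have etaN k : (N <= k)%N -> 2 * eta k <= (1 - q) / 2.
  move=> Nk; apply: le_trans (tail k.+1); rewrite big_nat_recr//= lerDr.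
  by apply: sumr_ge0.
have tail2 n : \sum_(N <= k < n) 2 * eta k <= 2^-1.
  by apply: (le_trans (tail n)); lra.
(* [N] is fixed before [w], so a solution can afterwards be chosen with [decaying w N = 0]. *)
exists N => w ws BN /growing_decaying_cvg0[A0 _].
have step k : (N <= k)%N -> modc (decaying w k) <= modc (growing w k) ->
    (1 - 2 * eta k) * modc (growing w k) <= modc (growing w k.+1) /\
    modc (decaying w k.+1) <= modc (growing w k.+1).
  move=> /etaN; have [hA hB] := pert w ws k; rewrite /size in hA hB.
  have : modc (growing w k) <=
      modc (growing w k.+1) + modc (growing w k.+1 - growing w k).
    by rewrite -{1}[growing w k](subKr (growing w k.+1)) modcB.
  have : modc (decaying w k.+1) <= q * modc (decaying w k) +
      modc (decaying w k.+1 - z ^+ 2 * decaying w k).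
    rewrite -{1}[decaying w k.+1](subrK (z ^+ 2 * decaying w k)) addrC.
    by rewrite (le_trans (modcD _ _))// lerD// modcM modcX.
  have := eta0 k; have := modc_ge0 (decaying w k).
  have := modc_ge0 (growing w k).
  move: hA hB; set A := modc (growing w k); set B := modc (decaying w k).
  set A' := modc (growing w k.+1); set B' := modc (decaying w k.+1).
  set e := eta k => hA hB A_ge0 B_ge0 e0 h1 h2 h3 h4.
  have h5 : e * (A + B) <= 2 * e * A by nra.
  have h6 : (1 - 2 * e) * A <= A' by lra.
  by split => //; apply: le_trans h6; nra.
have cone k : (N <= k)%N -> modc (decaying w k) <= modc (growing w k).
  elim: k => [|k IH]; first by rewrite leqn0 => /eqP <-; rewrite BN modc0 modc_ge0.
  rewrite leq_eqVlt => /orP[/eqP <-|]; first by rewrite BN modc0 modc_ge0.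
  by rewrite ltnS => Nk; exact: (step k Nk (IH Nk)).2.
apply/eqP; rewrite -modc_eq0 eq_le modc_ge0 andbT leNgt; apply/negP => AN.
have lb := @summable_lower_bound _ _ (fun k => modc (growing w k)) N eta2_ge0
  tail2 AN (fun k Nk => (step k Nk (cone k Nk)).1).
by have := cvg0_lower_bound A0 lb; lra.
Qed.

End Asymptotics.

(** * Wronskian and the decomposition of solutions along [orthopoly] and [assocpoly] *)

Section Resolvent.
Variables (R : realType) (alpha beta : nat -> R).
Hypothesis beta_gt0 : forall k, 0 < beta k.
Hypothesis K_trace : trace_class_perturbation alpha beta.

Lemma ell2_cvg0 (u : nat -> R[i]) : ell2 u ->
  (u : nat -> (R[i])^o) @ \oo --> (0 : (R[i])^o).
Proof.
move=> /cvg_series_cvg_0/cvgrPdist_lt h; apply/cvg0_modcP/cvgrPdist_lt => e e0.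
have e2 : 0 < e ^+ 2 by rewrite exprn_gt0.
apply: filterS (h _ e2) => k /=; rewrite !sub0r !normrN /sqmod -/(modc (u k)).
by rewrite normrX ltr_pXn2r// nnegrE ltW.
Qed.

Lemma recurrence_solution (P : nat -> {poly R}) (lam : R[i]) :
  jacobi_recurrence alpha beta P ->
  formal_solution alpha beta lam (fun k => evalC (P k) lam).
Proof.
move=> rec k; have := congr1 (fun p => evalC p lam) (rec k).
by rewrite /evalC rmorphM/= !rmorphD/= !map_polyZ map_polyX !hornerE.
Qed.

Local Notation p lam := (fun k => evalC (orthopoly alpha beta k) lam).
Local Notation q lam := (fun k => evalC (assocpoly alpha beta k) lam).

Lemma formal_solution_comb lam (a b : R[i]) v w :
  formal_solution alpha beta lam v -> formal_solution alpha beta lam w ->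
  formal_solution alpha beta lam (fun k => a * v k + b * w k).
Proof. by move=> hv hw k; rewrite mulrDr mulrCA hv (mulrCA lam) hw; ring. Qed.

Lemma betaC_neq0 k : (beta k)%:C != 0 :> R[i].
Proof. by rewrite -modc_eq0 modc_real normr_eq0 gt_eqF. Qed.

Lemma ortho0 lam : p lam 0%N = 1.
Proof. by rewrite /evalC rmorph1 hornerC. Qed.

Lemma assoc0 lam : q lam 0%N = 0.
Proof. by rewrite /evalC rmorph0 horner0. Qed.

Lemma ortho1 lam : (beta 0)%:C * p lam 1%N = lam - (alpha 0)%:C.
Proof.
rewrite /evalC /= subr0 mulr1 map_polyZ rmorphB/= map_polyX map_polyC.
by rewrite hornerZ hornerD hornerN hornerX hornerC fmorphV mulVKf ?betaC_neq0.
Qed.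

Lemma assoc1 lam : (beta 0)%:C * q lam 1%N = 1.
Proof.
rewrite /evalC /= map_polyC hornerC -[X in _ * X]/((beta 0)^-1)%:C.
by rewrite fmorphV divff ?betaC_neq0.
Qed.

(** The recurrence keeps the discrete Wronskian constant in [k], and the initial values make it 1 at
    [k = 0]. *)
Lemma wronskian lam k :
  (beta k)%:C * (p lam k * q lam k.+1 - p lam k.+1 * q lam k) = 1.
Proof.
have hp := recurrence_solution lam (orthopoly_recurrence alpha beta_gt0).
have hq := recurrence_solution lam (assocpoly_recurrence alpha beta_gt0).
elim: k => [|k IH]; first by rewrite ortho0 assoc0 mulr0 subr0 mul1r assoc1.
have := hp k; have := hq k; rewrite -{}IH.
set p0 := p lam k; set p1 := p lam k.+1; set p2 := p lam k.+2.
set q0 := q lam k; set q1 := q lam k.+1; set q2 := q lam k.+2.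
rewrite /= -/p0 -/p1 -/p2 -/q0 -/q1 -/q2 => eq ep.
have -> : (beta k.+1)%:C * (p1 * q2 - p2 * q1) =
  p1 * ((beta k.+1)%:C * q2) - ((beta k.+1)%:C * p2) * q1 by ring.
have -> : (beta k.+1)%:C * q2 =
  lam * q1 - (beta k)%:C * q0 - (alpha k.+1)%:C * q1 by rewrite eq; ring.
have -> : (beta k.+1)%:C * p2 =
  lam * p1 - (beta k)%:C * p0 - (alpha k.+1)%:C * p1 by rewrite ep; ring.
by ring.
Qed.

(** Here [s] is the source in row 0: it is 1 for the resolvent vector and 0 for an eigenvector. The
    difference of the two sides solves the recurrence and vanishes at 0 and 1. *)
Lemma solution_decomposition lam (s : R[i]) u :
  formal_solution alpha beta lam u ->
  (alpha 0)%:C * u 0%N + (beta 0)%:C * u 1%N = lam * u 0%N + s ->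
  forall k, u k = u 0%N * p lam k + s * q lam k.
Proof.
move=> us u01 k; apply/eqP; rewrite -subr_eq0; apply/eqP.
pose d k := 1 * u k + -1 * (u 0%N * p lam k + s * q lam k).
have -> : u k - (u 0%N * p lam k + s * q lam k) = d k by rewrite /d; ring.
have hp := recurrence_solution lam (orthopoly_recurrence alpha beta_gt0).
have hq := recurrence_solution lam (assocpoly_recurrence alpha beta_gt0).
apply: (@formal_solution_eq0 _ alpha beta beta_gt0 lam d 0).
- by apply: formal_solution_comb => //; exact: formal_solution_comb.
- by rewrite /d ortho0 assoc0; ring.
- apply: (mulfI (betaC_neq0 0)); rewrite mulr0 /d.
  have -> : (beta 0)%:C * (1 * u 1%N + -1 * (u 0%N * p lam 1%N + s * q lam 1%N)) =
    (beta 0)%:C * u 1%N - u 0%N * ((beta 0)%:C * p lam 1%N)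
    - s * ((beta 0)%:C * q lam 1%N) by ring.
  rewrite ortho1 assoc1.
  have -> : (beta 0)%:C * u 1%N = lam * u 0%N + s - (alpha 0)%:C * u 0%N.
    by rewrite -u01; ring.
  by ring.
Qed.

(** * Resolvent vector and eigenvectors in terms of the symbols *)

Variables (c cmu : nat -> nat -> R).
Hypothesis c_connection : connection_matrix (orthopoly alpha beta) c.
Hypothesis cmu_connection : connection_matrix (assocpoly alpha beta) cmu.

Let p_cvg := connection_symbol_cvg beta_gt0 K_trace
  (orthopoly_recurrence alpha beta_gt0) c_connection.
Let q_cvg := connection_symbol_cvg beta_gt0 K_trace
  (assocpoly_recurrence alpha beta_gt0) cmu_connection.

Lemma sqr_neq1_disc (z : R[i]) : modc z < 1 -> z ^+ 2 != 1.
Proof.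
move=> z1; apply/eqP => e; have := congr1 (@modc R) e.
rewrite modcX modc1 => h; have : modc z ^+ 2 < 1 by rewrite expr_lt1// modc_ge0.
by rewrite h ltxx.
Qed.

(** If both symbols vanished, z^k w k would tend to 0 for every combination [w] of the two
    polynomial solutions, including one that [disc_cone] forbids. *)
Lemma symbols_no_common_zero (z : R[i]) : modc z < 1 -> z != 0 ->
  toeplitz_symbol c z = 0 -> toeplitz_symbol cmu z <> 0.
Proof.
move=> z1 z0 cz cmuz; have z2 := sqr_neq1_disc z1.
have z2' : 1 - z ^+ 2 != 0 by rewrite subr_eq0 eq_sym.
pose lam := joukowski z.
have weaken (u : nat -> R[i]) :
    (fun k => (1 - z ^+ 2) * (z ^+ k * u k) : (R[i])^o) @ \oo --> (0 : (R[i])^o) ->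
    (fun k => modc (z ^+ k * u k)) @ \oo --> (0 : R).
  move=> /cvg0_modcP/(@cvgMl_tmp _ _ _ _ _ (modc (1 - z ^+ 2))^-1).
  rewrite mulr0; apply: cvg_trans; apply: near_eq_cvg; apply: nearW => k.
  by rewrite /= (modcM (1 - z ^+ 2)) mulKf// modc_eq0.
have p0 : (fun k => modc (z ^+ k * p lam k)) @ \oo --> (0 : R).
  by apply: weaken; rewrite -cz; exact: p_cvg.
have q0 : (fun k => modc (z ^+ k * q lam k)) @ \oo --> (0 : R).
  by apply: weaken; rewrite -cmuz; exact: q_cvg.
have [N hN] := disc_cone beta_gt0 K_trace z0 (ltW z1) z2 z1.
(* These coefficients cancel the decaying component of [w] at [N]. *)
pose x := decaying beta z (q lam) N; pose y := - decaying beta z (p lam) N.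
pose w k := x * p lam k + y * q lam k.
have ws : formal_solution alpha beta lam w.
  by apply: formal_solution_comb; apply: recurrence_solution;
    [exact: orthopoly_recurrence|exact: assocpoly_recurrence].
have w0 : (fun k => modc (z ^+ k * w k)) @ \oo --> (0 : R).
  have h : (fun k => modc x * modc (z ^+ k * p lam k) +
      modc y * modc (z ^+ k * q lam k)) @ \oo --> (0 : R).
    have := cvgD (@cvgMl_tmp _ _ _ _ _ (modc x) _ p0)
      (@cvgMl_tmp _ _ _ _ _ (modc y) _ q0).
    by rewrite !mulr0 addr0; apply.
  apply: (squeeze_cvgr _ (cvg_cst 0) h); apply: nearW => k; rewrite modc_ge0/=.
  by rewrite -!modcM (le_trans _ (modcD _ _))// /w mulrDr !(mulrCA (z ^+ k)).
have wB : decaying beta z w N = 0.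
  by rewrite /w /x /y /decaying; ring.
have := hN w ws wB w0.
(* The growing component is then a two-by-two determinant, a nonzero multiple of the Wronskian. *)
have -> : growing beta z w N = 2 * z ^+ N * z ^+ N * (1 - z ^+ 2) *
    ((beta N)%:C * (p lam N * q lam N.+1 - p lam N.+1 * q lam N)).
  by rewrite /w /x /y /growing /decaying; ring.
rewrite wronskian mulr1 => /eqP; rewrite !mulf_eq0 (negbTE z2') orbF.
by rewrite !expf_eq0 (negbTE z0) !andbF !orbF pnatr_eq0.
Qed.

(** The limit of (1 - z^2) z^k u k is computed twice: from the decomposition of [u], and as 0
    because [u] tends to 0. *)
Lemma decaying_solution_relation (z s : R[i]) u : modc z < 1 -> z != 0 ->
  formal_solution alpha beta (joukowski z) u ->
  (alpha 0)%:C * u 0%N + (beta 0)%:C * u 1%N = joukowski z * u 0%N + s ->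
  (u : nat -> (R[i])^o) @ \oo --> (0 : (R[i])^o) ->
  u 0%N * toeplitz_symbol c z + s * toeplitz_symbol cmu z = 0.
Proof.
move=> z1 z0 us u01 ucvg.
have uE := solution_decomposition us u01.
have lim1 : (fun k => (1 - z ^+ 2) * (z ^+ k * u k) : (R[i])^o) @ \oo -->
    (u 0%N * toeplitz_symbol c z + s * toeplitz_symbol cmu z : (R[i])^o).
  have -> : (fun k => (1 - z ^+ 2) * (z ^+ k * u k)) = (fun k =>
      u 0%N * ((1 - z ^+ 2) * (z ^+ k * p (joukowski z) k)) +
      s * ((1 - z ^+ 2) * (z ^+ k * q (joukowski z) k))).
    by apply/funext => k; rewrite {1}uE; ring.
  apply: cvgD; apply: cvgMr; [exact: p_cvg|exact: q_cvg].
apply: (cvg_complex_unique lim1).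
apply: (@cvg0_modc_le _ _ (fun k => modc (1 - z ^+ 2) * modc (u k))).
  move=> k; rewrite !modcM ler_wpM2l ?modc_ge0// ler_piMl ?modc_ge0//.
  by rewrite modcX exprn_ile1 ?modc_ge0// ltW.
rewrite -(mulr0 (modc (1 - z ^+ 2))); apply: cvgMr.
exact/cvg0_modcP.
Qed.

Lemma inner_e0 (v : nat -> R[i]) : inner (@e0 R) v = v 0%N.
Proof.
rewrite /inner; apply: cvg_complex_lim; rewrite -cvg_shiftS.
have -> : (fun n => series (fun k => (@e0 R k)^* * v k : (R[i])^o) n.+1) =
    cst (v 0%N).
  apply/funext => n; rewrite /series/= big_nat_recl// big1 => [|k _].
    by rewrite /e0 eqxx mulr1n rmorph1 mul1r addr0.
  by rewrite /e0 /= mulr0n rmorph0 mul0r.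
exact: cvg_cst.
Qed.

Lemma ell2_e0 : ell2 (@e0 R).
Proof.
rewrite /ell2/=; apply/cvg_ex; exists 1; rewrite -cvg_shiftS.
have -> : (fun n => series (fun k => sqmod (@e0 R k)) n.+1) = cst 1.
  apply/funext => n; rewrite /series/= big_nat_recl// big1 => [|k _].
    by rewrite /sqmod /e0 eqxx mulr1n -/(modc 1) modc1 expr1n addr0.
  by rewrite /sqmod -/(modc _) (_ : @e0 R k.+1 = 0)// modc0 expr0n.
exact: cvg_cst.
Qed.

Lemma resolvent_e0 (T : (nat -> R[i]) -> nat -> R[i]) lam :
  ~ spectrum T lam ->
  ell2 (resolvent T lam (@e0 R)) /\
  shift_operator T lam (resolvent T lam (@e0 R)) = @e0 R.
Proof.
(* Surjectivity makes the partial inverse a right inverse on [ell2]. *)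
move=> /contrapT[[_ _ surj] [bnd _ _]]; split; first exact: bnd ell2_e0.
have e0in : @e0 R \in @ell2 R by rewrite inE; exact: ell2_e0.
exact: surjpK surj _ e0in.
Qed.

Lemma principal_resolvent_symbol (z : R[i]) : modc z < 1 -> z != 0 ->
  ~ spectrum (tridiag alpha beta) (joukowski z) ->
  toeplitz_symbol c z != 0 /\
  principal_resolvent (tridiag alpha beta) (joukowski z)
    = - (toeplitz_symbol cmu z / toeplitz_symbol c z).
Proof.
move=> z1 z0 /resolvent_e0[]; rewrite /principal_resolvent inner_e0.
set u := resolvent _ _ _ => /ell2_cvg0 ucvg uE.
have row k : tridiag alpha beta u k = joukowski z * u k + @e0 R k.
  by rewrite -uE /shift_operator addrC subrK.
have us : formal_solution alpha beta (joukowski z) u.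
  by move=> k; have := row k.+1; rewrite /tridiag /e0/= addr0 => <-.
have u01 : (alpha 0)%:C * u 0%N + (beta 0)%:C * u 1%N = joukowski z * u 0%N + 1.
  by have := row 0%N; rewrite /tridiag /e0/= add0r.
have := decaying_solution_relation z1 z0 us u01 ucvg; rewrite mul1r => rel.
have cz : toeplitz_symbol c z != 0.
  (* A zero of [c] would by [rel] also be a zero of [cmu]. *)
  apply/eqP => cz; apply: (symbols_no_common_zero z1 z0 cz).
  by move: rel; rewrite cz mulr0 add0r.
split => //; apply: (mulIf cz); rewrite mulNr divfK//.
by apply/eqP; rewrite -addr_eq0 rel.
Qed.

(** The roots of z^2 - 2 lam z + 1 have product 1, so one of them lies in the closed disc. *)
Lemma joukowski_surj (lam : R[i]) :
  exists z, [/\ z != 0, modc z <= 1 & lam = joukowski z].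
Proof.
pose s := sqrtc (lam ^+ 2 - 1).
have s2 : s ^+ 2 = lam ^+ 2 - 1 by rewrite sqr_sqrtc.
have prod1 : (lam - s) * (lam + s) = 1 by rewrite -subr_sqr s2 subKr.
have jE z z' : z * z' = 1 -> z + z' = 2 * lam -> z != 0 /\ lam = joukowski z.
  move=> zz' e; have z0 : z != 0.
    by apply/eqP => z0; move: zz'; rewrite z0 mul0r => /eqP; rewrite eq_sym oner_eq0.
  split => //; rewrite /joukowski.
  have -> : z^-1 = z' by apply: (mulfI z0); rewrite divff.
  by rewrite e mulKf// pnatr_eq0.
have m : modc (lam - s) * modc (lam + s) = 1 by rewrite -modcM prod1 modc1.
have [h|h] := leP (modc (lam - s)) 1.
  have [] := jE (lam - s) (lam + s) prod1; first by ring.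
  by exists (lam - s).
have [] := jE (lam + s) (lam - s); [by rewrite mulrC|by ring|move=> h0 h1].
exists (lam + s); split => //; rewrite leNgt; apply/negP => h2.
by have := modc_ge0 (lam + s); nra.
Qed.

(** An eigenvector is [u 0] times the sequence of orthonormal polynomials, with [u 0] nonzero, so
    the relation with source 0 forces the symbol to vanish. *)
Lemma eigenvalue_symbol_root (lam : R[i]) :
  is_eigenvalue (tridiag alpha beta) lam -> lam != 1 -> lam != -1 ->
  exists z : R[i],
    [/\ modc z < 1, z != 0, toeplitz_symbol c z = 0 & lam = joukowski z].
Proof.
move=> [u [/ell2_cvg0 ucvg u0 Ju]] lam1 lamN1.
have [z [z0 zle lamE]] := joukowski_surj lam.
have row k : tridiag alpha beta u k = lam * u k by rewrite Ju.
have us : formal_solution alpha beta (joukowski z) u.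
  by move=> k; rewrite -lamE -row.
have u01 : (alpha 0)%:C * u 0%N + (beta 0)%:C * u 1%N = joukowski z * u 0%N + 0.
  by rewrite addr0 -lamE -row /tridiag add0r.
(* The excluded edges 1 and -1 are the images of z = 1 and z = -1. *)
have z2 : z ^+ 2 != 1.
  have two0 : 2 != 0 :> R[i] by rewrite pnatr_eq0.
  rewrite sqrf_eq1 negb_or; apply/andP; split; apply/eqP => zE.
    by case/eqP: lam1; rewrite lamE zE /joukowski; field.
  by case/eqP: lamN1; rewrite lamE zE /joukowski; field.
have z1 : modc z < 1.
  rewrite lt_neqAle zle andbT; apply/eqP => zE.
  by apply: u0; apply/funext; exact: unit_circle_no_decay zE us ucvg.
exists z; split => //.
have /eqP := decaying_solution_relation z1 z0 us u01 ucvg.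
rewrite mul0r addr0 mulf_eq0 => /orP[/eqP u00|/eqP//].
case: u0; apply/funext => k.
by rewrite (solution_decomposition us u01) u00 !mul0r addr0.
Qed.

End Resolvent.

Theorem theorem5p15 (R : realType) (alpha beta : nat -> R)
    (c cmu : nat -> nat -> R)
    (J_jacobi : jacobi alpha beta)
    (K_trace_class : trace_class_perturbation alpha beta)
    (c_connection : connection_matrix (orthopoly alpha beta) c)
    (cmu_connection : connection_matrix (assocpoly alpha beta) cmu) :
  let J := tridiag alpha beta in
  [/\ has_toeplitz_symbol c,
      has_toeplitz_symbol cmu,
      forall z : R[i], `|z| < 1 -> z != 0 -> ~ spectrum J (joukowski z) ->
        toeplitz_symbol c z != 0 /\
        principal_resolvent J (joukowski z)
          = - (toeplitz_symbol cmu z / toeplitz_symbol c z)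
    & forall lam : R[i], is_eigenvalue J lam -> lam != 1 -> lam != -1 ->
        exists z : R[i],
          [/\ `|z| < 1, z != 0, toeplitz_symbol c z = 0 & lam = joukowski z]].
Proof.
move=> J; have [beta_gt0 _] := J_jacobi.
split.
- exact: (connection_has_symbol beta_gt0 K_trace_class
    (orthopoly_recurrence alpha beta_gt0) c_connection).
- exact: (connection_has_symbol beta_gt0 K_trace_class
    (assocpoly_recurrence alpha beta_gt0) cmu_connection).
- move=> z; rewrite normr_lt1_modc => z1 z0 Jz.
  exact: (principal_resolvent_symbol beta_gt0 K_trace_class c_connection
    cmu_connection z1 z0 Jz).
- move=> lam Jlam lam1 lamN1.
  have [z [z1 z0 cz lamE]] := eigenvalue_symbol_root beta_gt0 K_trace_class
    c_connection cmu_connection Jlam lam1 lamN1.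
  by exists z; rewrite normr_lt1_modc.
Qed.
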